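(* Let $\mathcal L=\{L_i:i\in I\}$ be a family of pairwise distinct compact convex sets in $\mathbb R^d$ such that $\mathrm{conv}(\mathcal L)$ is compact and $\dim\mathrm{conv}(\mathcal L)>0$, and which are in general position. Let $$\mathcal C(\mathcal L)=\Bigl\{i\in I:\mathrm{conv}\Bigl(\bigcup_{k\in I}L_k\Bigr)\ne\mathrm{conv}\Bigl(\bigcup_{k\in I\setminus\{i\}}L_k\Bigr)\Bigr\}$$ be the set of indices of contributing sets. Then $$\mathrm{conv}(\mathcal L)=\mathrm{conv}\Bigl(\bigcup_{i\in\mathcal C(\mathcal L)}L_i\Bigr).$$
   Context: For a family $\mathcal L=\{L_i:i\in I\}$ of sets, $\mathrm{conv}(\mathcal L)$ is the convex hull of $\bigcup_{i\in I}L_i$; $\dim$ is the affine dimension. An exposed face of a compact convex set $C$ is a set $C\cap H$ with $H$ a supporting hyperplane of $C$. A family $\mathcal L$ as in the claim (compact convex hull of positive dimension) is said to be in general position if, for each closed convex subset $A$ of each exposed face of $\mathrm{conv}(\mathcal L)$, the family $\mathcal M(\mathcal L,A)=\{L\in\mathcal L:L\cap A\neq\varnothing\}$ is finite and $$\sum_{L\in\mathcal M(\mathcal L,A)}(1+\dim(A\cap L))\le\dim(A)+1.$$ *)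

(* Defs.v *)
From mathcomp Require Import all_boot all_order all_algebra.
From mathcomp Require Import all_classical all_reals all_analysis.

Set Implicit Arguments.
Unset Strict Implicit.
Unset Printing Implicit Defensive.

Import Order.TTheory GRing.Theory Num.Theory.
Import numFieldNormedType.Exports.

Local Open Scope classical_set_scope.
Local Open Scope ring_scope.

Section ConvexGeometry.
Context {R : realType} {d : nat}.
Local Notation V := 'rV[R]_d.
Implicit Types (A C H K : set V).

Definition conv_hull A : set V := smallest (@convex_set R V) A.

Definition affinely_independent (k : nat) (x : 'I_k -> V) : Prop :=
  forall a : 'I_k -> R, \sum_i a i = 0 -> \sum_i a i *: x i = 0 ->
    forall i, a i = 0.

(* One less than the largest number of affinely independent points of A; this
   number is at most d + 1.  In particular, aff_dim set0 = -1. *)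
Definition aff_dim A : int :=
  (\max_(k < d.+2 | `[< exists x : 'I_k -> V,
      (forall i, A (x i)) /\ affinely_independent x >]) k)%N%:Z - 1.

(* A supporting hyperplane is allowed to contain C. *)
Definition supporting_hyperplane C H : Prop :=
  exists (u : V) (c : R),
    [/\ u != 0,
        H = [set x | \sum_i u 0 i * x 0 i = c],
        (forall x, C x -> \sum_i u 0 i * x 0 i <= c) &
        C `&` H !=set0].

Definition exposed_face C F : Prop :=
  exists2 H, supporting_hyperplane C H & F = C `&` H.

Section Family.
Context {I : Type}.
Variable L : I -> set V.

Definition meeting A : set (set V) :=
  [set K | range L K /\ K `&` A !=set0].

Definition general_position : Prop :=
  forall F A, exposed_face (conv_hull (\bigcup_i L i)) F ->
    A `<=` F -> closed A -> @convex_set R V A ->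
    finite_set (meeting A) /\
    \sum_(K \in meeting A) (1 + aff_dim (A `&` K)) <= aff_dim A + 1.

Definition contributing : set I :=
  [set i | conv_hull (\bigcup_k L k) <>
           conv_hull (\bigcup_(k in ~` [set i]) L k)].

End Family.
End ConvexGeometry.

(* Main.v *)
(* Write C for conv(L).  An extreme point z of C lies in an exposed face, so
   general position for the singleton A = {z} allows only one member L_i to
   contain z.  Since C \ {z} is convex and contains every L_k with k <> i,
   removing L_i would remove z from the hull: L_i is contributing.  By
   Minkowski's theorem the extreme points span C.

   Minkowski's theorem is used in the form: if A is convex and x in C is not
   in A, then some extreme point of C is not in A.  Separate x from A weakly by
   u; the face of C maximising u contains x itself or a point strictly beyond
   x, hence in both cases a point outside A, and it has smaller dimension. *)

Require Import Defs.
From mathcomp Require Import all_boot all_order all_algebra.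
From mathcomp Require Import all_classical all_reals all_analysis.
From mathcomp Require Import ring lra.

Set Implicit Arguments.
Unset Strict Implicit.
Unset Printing Implicit Defensive.

Import Order.TTheory GRing.Theory Num.Theory.
Import numFieldNormedType.Exports.

Local Open Scope classical_set_scope.
Local Open Scope ring_scope.

(** * The Euclidean inner product, convex combinations and finite separation *)

Section Dot.
Context {R : realType} {d : nat}.
Local Notation V := 'rV[R]_d.
Implicit Types (u v w : V) (A : set V).

Definition dot u v : R := \sum_i u 0 i * v 0 i.

Lemma dotC u v : dot u v = dot v u.
Proof. by apply: eq_bigr => i _; rewrite mulrC. Qed.

Lemma dotDr u v w : dot u (v + w) = dot u v + dot u w.
Proof. by rewrite /dot -big_split; apply: eq_bigr => i _; rewrite mxE mulrDr. Qed.

Lemma dotZr u (t : R) v : dot u (t *: v) = t * dot u v.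
Proof. by rewrite /dot mulr_sumr; apply: eq_bigr => i _; rewrite mxE mulrCA. Qed.

Lemma dotBr u v w : dot u (v - w) = dot u v - dot u w.
Proof. by rewrite -scaleN1r dotDr dotZr mulN1r. Qed.

Lemma dotZl (t : R) u v : dot (t *: u) v = t * dot u v.
Proof. by rewrite dotC dotZr dotC. Qed.

Lemma dot_gt0 u : u != 0 -> 0 < dot u u.
Proof.
move=> /rV0Pn[i ui0].
rewrite /dot (bigD1 i)//= ltr_pwDl//; last first.
  by apply: sumr_ge0 => j _; rewrite -expr2 sqr_ge0.
by rewrite -expr2 lt_neqAle sqr_ge0 eq_sym sqrf_eq0 ui0.
Qed.

Lemma dot_mulmx u v : u *m v^T = (dot u v)%:M.
Proof.
by apply/rowP => j; rewrite ord1 !mxE mulr1n; apply: eq_bigr => i _; rewrite mxE.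
Qed.

Lemma dot_continuous (T : topologicalType) (f g : T -> V) :
  continuous f -> continuous g -> continuous (fun x => dot (f x) (g x)).
Proof.
move=> cf cg; apply: continuous_big => [|i _]; first exact: add_continuous.
move=> x; apply: continuousM.
  exact: (continuous_comp (cf x) (@coord_continuous _ _ _ _ _ _)).
exact: (continuous_comp (cg x) (@coord_continuous _ _ _ _ _ _)).
Qed.

Lemma convex_setP A : @convex_set R V A <->
  forall (t : R) u v, 0 < t < 1 -> A u -> A v -> A (t *: u + (1 - t) *: v).
Proof.
rewrite convex_setW; split=> cA.
  move=> t u v /andP[t0 t1] Au Av.
  by have := cA u v _ _ (Itv01 (ltW t0) (ltW t1)); rewrite !inE; apply.
move=> u v; rewrite !inE => Au Av t t0 t1.
by rewrite inE; apply: cA; rewrite ?t0.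
Qed.

(** Induction on [n]: the tail is renormalised by its weight [s = 1 - b] and then combined with the
    first point. The cases [s = 0] and [b = 0] are separate because [convex_setP] only takes weights
    strictly between 0 and 1. *)
Lemma convex_sum A n (a : 'I_n -> R) (y : 'I_n -> V) :
  @convex_set R V A -> (forall i, 0 <= a i) -> \sum_i a i = 1 ->
  (forall i, A (y i)) -> A (\sum_i a i *: y i).
Proof.
move=> /convex_setP cA; elim: n a y => [|n IH] a y a0 a1 Ay.
  by move/eqP: a1; rewrite big_ord0 eq_sym oner_eq0.
rewrite big_ord_recl; move: a1; rewrite big_ord_recl.
set b := a ord0; set s := \sum_i _ => bs.
have s0 : 0 <= s by apply: sumr_ge0.
have [s_eq0|sN0] := eqVneq s 0.
  rewrite big1 ?addr0; last first.
    move=> i _; move/eqP: s_eq0; rewrite psumr_eq0//.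
    move=> /allP/(_ i); rewrite mem_index_enum => /(_ isT)/eqP ->.
    exact: scale0r.
  by move: bs; rewrite s_eq0 addr0 => ->; rewrite scale1r.
have s_gt0 : 0 < s by rewrite lt_neqAle eq_sym sN0.
have IHs : A (\sum_i (a (lift ord0 i) / s) *: y (lift ord0 i)).
  apply: IH => // [i|]; first by rewrite divr_ge0.
  by rewrite -mulr_suml divff.
have -> : \sum_i a (lift ord0 i) *: y (lift ord0 i) =
          s *: (\sum_i (a (lift ord0 i) / s) *: y (lift ord0 i)).
  rewrite scaler_sumr; apply: eq_bigr => i _.
  by rewrite scalerA mulrC divfK.
have [b0|bN0] := eqVneq b 0.
  by move: bs; rewrite b0 scale0r !add0r => s1; rewrite [X in X *: _]s1 scale1r.
have sE : s = 1 - b by rewrite -bs addrAC subrr add0r.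
rewrite [X in X *: (\sum_i _)]sE; apply: cA => //.
by rewrite sE in s_gt0; rewrite lt_neqAle eq_sym bN0 a0/= -subr_gt0.
Qed.

Lemma compact_simplex n :
  compact [set a : 'rV[R]_n | (forall i, 0 <= a 0 i) /\ \sum_i a 0 i = 1].
Proof.
pose B := [set a : 'rV[R]_n | forall i, a 0 i \in `[0, 1]].
have cB : compact B.
  apply: (@rV_compact _ _ (fun=> `[0 : R, 1]%classic)).
  by move=> i; exact: segment_compact.
have cl1 : closed ((fun a : 'rV[R]_n => \sum_i a 0 i) @^-1` [set x | x = 1]).
  apply: preimage_closed; last exact: closed_eq.
  apply: in1W; apply: (@continuous_big _ _ +%R 0 xpredT) => [|i _].
    exact: add_continuous.
  exact: coord_continuous.
have -> : [set a : 'rV[R]_n | (forall i, 0 <= a 0 i) /\ \sum_i a 0 i = 1] =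
  B `&` ((fun a : 'rV[R]_n => \sum_i a 0 i) @^-1` [set x | x = 1]).
  apply/seteqP; split=> a /= [a0 a1]; split=> // i; last first.
    by have := a0 i; rewrite in_itv/= => /andP[].
  rewrite in_itv/= a0/= -a1 (bigD1 i)//= lerDl.
  by apply: sumr_ge0.
exact: compact_closedI.
Qed.

(* The minimiser p of the Euclidean norm over the hull of the y i satisfies
   dot p (y i) >= dot p p for all i. *)
Lemma finite_separation (S : 'M[R]_d) n (y : 'I_n -> V) :
  S != 0 -> (forall i, (y i <= S)%MS) ->
  (forall a : 'I_n -> R, (forall i, 0 <= a i) -> \sum_i a i = 1 ->
    \sum_i a i *: y i != 0) ->
  exists u, [/\ u != 0, (u <= S)%MS & forall i, 0 <= dot u (y i)].
Proof.
move=> /rowV0Pn[v vS v0]; case: n y => [|n] y yS y0.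
  (* With no points the sign condition is vacuous, and any nonzero vector of [S] serves. *)
  by exists v; split=> // -[].
pose T := [set a : 'rV[R]_n.+1 | (forall i, 0 <= a 0 i) /\ \sum_i a 0 i = 1].
pose q (a : 'rV[R]_n.+1) : V := \sum_i a 0 i *: y i.
have T_delta i : T (delta_mx 0 i).
  split=> [j|]; first by rewrite mxE ler0n.
  rewrite (bigD1 i)//= big1 ?addr0 ?mxE ?eqxx// => j ji.
  by rewrite mxE (negPf ji) andbF.
have qD a b : q (a + b) = q a + q b.
  by rewrite /q -big_split; apply: eq_bigr => i _; rewrite mxE scalerDl.
have qZ t a : q (t *: a) = t *: q a.
  by rewrite /q scaler_sumr; apply: eq_bigr => i _; rewrite mxE scalerA.
have q_delta i : q (delta_mx 0 i) = y i.
  rewrite /q (bigD1 i)//= big1 ?addr0 ?mxE ?eqxx ?scale1r// => j ji.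
  by rewrite mxE (negPf ji) andbF scale0r.
have q_cont : continuous q.
  apply: continuous_big => [|i _]; first exact: add_continuous.
  move=> a; apply: continuousZr_tmp; exact: coord_continuous.
have [a /set_mem[a0 a1] a_min] : exists2 a, a \in T &
    forall b, b \in T -> dot (q a) (q a) <= dot (q b) (q b).
  apply: EVT_min_rV; first by exists (delta_mx 0 ord0).
    exact: compact_simplex.
  apply: continuous_subspaceT; exact: dot_continuous.
exists (q a); split; first exact: y0.
  by apply: summx_sub => i _; rewrite scalemx_sub.
move=> i; rewrite leNgt; apply/negP => pi_lt0.
have [p [pE p_gt0]] : exists p, p = dot (q a) (q a) /\ 0 < p.
  by exists (dot (q a) (q a)); split=> //; apply: dot_gt0; exact: y0.
have [r [rE r_ge0]] : exists r, r = dot (y i) (y i) /\ 0 <= r.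
  exists (dot (y i) (y i)); split=> //; apply: sumr_ge0 => j _.
  by rewrite -expr2 sqr_ge0.
(* If [dot (q a) (y i) < 0], moving from [q a] towards [y i] shortens it. This [t] minimises
   [t^2 r + (1 - t)^2 p], the squared norm without its negative cross term; the minimum lies [t p]
   below [p]. *)
pose t := p / (p + r).
have t01 : 0 < t <= 1.
  by rewrite divr_gt0 ?ler_pdivrMr ?mul1r ?lerDl ?ltr_wpDr.
have {a_min} := a_min (t *: delta_mx 0 i + (1 - t) *: a).
have /[swap]/[apply] : t *: delta_mx 0 i + (1 - t) *: a \in T.
  rewrite inE; have [d0 d1] := T_delta i; split=> [j|].
    rewrite mxE; apply: addr_ge0; rewrite mxE mulr_ge0//; lra.
  transitivity (t * (\sum_j (delta_mx 0 i : 'rV[R]_n.+1) 0 j) +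
               (1 - t) * \sum_j a 0 j); last by rewrite d1 a1; ring.
  by rewrite !mulr_sumr -big_split; apply: eq_bigr => j _; rewrite !mxE.
rewrite qD !qZ q_delta !dotDr ![dot (_ + _) _]dotC !dotDr !dotZr !dotZl.
rewrite ![dot (y i) (q a)]dotC -pE -rE.
have tE : t * (p + r) = p by rewrite divfK// gt_eqF ?ltr_wpDr.
move: (dot (q a) (y i)) pi_lt0 => e e_lt0 le_p.
case/andP: t01 => t_gt0 t_le1.
have h : 0 <= t * (1 - t) * (- e).
  by apply: mulr_ge0; [apply: mulr_ge0; lra | lra].
have : 0 <= t * (t * (p + r) - 2 * p) by lra.
have tp_gt0 : 0 < t * p by rewrite mulr_gt0.
by rewrite tE; lra.
Qed.
End Dot.

(** * Weak separation in a subspace, and extreme points *)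

Section Separation.
Context {R : realType} {d : nat}.
Local Notation V := 'rV[R]_d.
Implicit Types (u x y z : V) (A C : set V) (S : 'M[R]_d).

Lemma compact_unit_sphere S : compact [set u : V | `|u| = 1 /\ (u <= S)%MS].
Proof.
apply: bounded_closed_compact.
  by exists 1; split=> // t t_gt1 u [u1 _] /=; rewrite u1 ltW.
(* The row space of [S] is the common zero set of the linear forms given by the columns of
   [cokermx S]. *)
have -> : [set u : V | `|u| = 1 /\ (u <= S)%MS] =
    (Num.norm : V -> R) @^-1` [set r | r = 1] `&`
    \bigcap_j ((fun u => dot (row j (cokermx S)^T) u) @^-1` [set r | r = 0]).
  apply/seteqP; split=> u /= [u1 uS]; split=> //.
    move=> j _ /=; move: uS; rewrite submxE => /eqP/rowP/(_ j).
    rewrite !mxE => uE; rewrite -[RHS]uE; apply: eq_bigr => i _.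
    by rewrite !mxE mulrC.
  rewrite submxE; apply/eqP/rowP => j; rewrite !mxE -[RHS](uS j I).
  by apply: eq_bigr => i _; rewrite !mxE mulrC.
apply: closedI.
  apply: preimage_closed; last exact: closed_eq.
  by apply: in1W; exact: norm_continuous.
apply: closed_bigI => j _; apply: preimage_closed; last exact: closed_eq.
by apply: in1W; apply: dot_continuous => u; [exact: cst_continuous|].
Qed.

(* The half-spaces {u | dot u y <= dot u x} are closed; finite_separation gives
   their finite intersection property on the unit sphere of S.  The index y = x
   only keeps the family nonempty. *)
Lemma separation S A x : S != 0 -> @convex_set R V A -> ~ A x ->
  exists u, [/\ u != 0, (u <= S)%MS &
    forall y, A y -> (y - x <= S)%MS -> dot u y <= dot u x].
Proof.
move=> S0 cA nAx.
pose K := [set u : V | `|u| = 1 /\ (u <= S)%MS].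
pose D := [set y | y = x \/ A y /\ (y - x <= S)%MS].
pose f y := K `&` [set u | 0 <= dot u (x - y)].
have := @compact_unit_sphere S; rewrite compact_In0 => /(_ V D f)[| |u Du].
- exists (fun y => [set u | 0 <= dot u (x - y)]) => // y _.
  apply: (@preimage_closed _ _ (fun u => dot u (x - y)) [set r | 0 <= r]).
    by apply: in1W; apply: dot_continuous => u //; exact: cst_continuous.
  exact: closed_ge.
- move=> E ED.
  (* The index [x] need not lie in [A]; its constraint [0 <= dot u (x - x)] holds trivially. *)
  pose s := [seq y <- finmap.enum_fset E | y != x].
  have sA y : y \in s -> A y /\ (y - x <= S)%MS.
    by rewrite mem_filter => /andP[/eqP yx /ED]; rewrite inE => -[].
  have sn (i : 'I_(size s)) : nth 0 s i \in s by exact: mem_nth.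
  have [i|a a0 a1|u [u0 uS us]] :=
      @finite_separation R d S _ (fun i : 'I_(size s) => x - nth 0 s i) S0.
  + by rewrite -opprB -scaleN1r scalemx_sub//; have [] := sA _ (sn i).
  (* A vanishing convex combination of the differences would exhibit [x] as a convex combination of
     points of [A]. *)
  + apply/eqP => eq0; apply: nAx.
    have -> : x = \sum_i a i *: nth 0 s i.
      apply/eqP; rewrite -subr_eq0 -[X in X - _]scale1r -a1 scaler_suml -sumrB.
      by rewrite -[X in _ == X]eq0; apply/eqP/eq_bigr => i _; rewrite scalerBr.
    by apply: convex_sum => // i; have [] := sA _ (sn i).
  exists (`|u|^-1 *: u) => y /= Ey; split.
    split; last exact: scalemx_sub.
    by rewrite normrZ normfV normr_id mulVf// normr_eq0.
  rewrite /= dotZl mulr_ge0 ?invr_ge0//.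
  have [->|yx] := eqVneq y x; first by rewrite dotBr subrr.
  have ys : y \in s by rewrite mem_filter yx.
  have ltys : (index y s < size s)%N by rewrite index_mem.
  by have := us (Ordinal ltys); rewrite /= nth_index.
have [[u1 uS] _] : f x u by apply: Du; left.
exists u; split=> //; first by rewrite -normr_eq0 u1 oner_eq0.
move=> y Ay yS; have [_ /=] : f y u by apply: Du; right.
by rewrite dotBr subr_ge0.
Qed.

(** For convex [C] this says that no open segment between two other points of [C] contains [z]. In
    this form [C] without [z] can be fed directly to [separation] and to the minimality of the
    hull. *)
Definition extreme_point C z := C z /\ @convex_set R V (C `\ z).

(** A weighted mean of two values at most [m] equals [m] only if both do, so a segment of [C]
    through [z] has its endpoints in the face. *)
Lemma extreme_point_face C u (m : R) z : @convex_set R V C ->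
  (forall y, C y -> dot u y <= m) ->
  extreme_point (C `&` [set y | dot u y = m]) z -> extreme_point C z.
Proof.
move=> /convex_setP cC Cm [[Cz zm] /convex_setP cFz]; split=> //.
apply/convex_setP => t x y t01 [Cx xz] [Cy yz]; split; first exact: cC.
move=> tz; have := zm; rewrite /= -tz dotDr !dotZr => um.
have [xm ym] := (Cm _ Cx, Cm _ Cy).
have {}xm : dot u x = m by nra.
have {}ym : dot u y = m by nra.
by have [] := cFz t x y t01 (conj (conj Cx xm) xz) (conj (conj Cy ym) yz).
Qed.

Lemma extreme_point_outside C A x : @convex_set R V C -> compact C ->
  @convex_set R V A -> C x -> ~ A x -> exists2 z, extreme_point C z & ~ A z.
Proof.
(* Induction on a bound for the rank of a matrix S whose row space contains all
   directions y - x with y in C; the faces of C shrink S. *)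
move=> + + cA.
have : forall y, C y -> (y - x <= (1%:M : 'M[R]_d))%MS by move=> *; exact: submx1.
have : (\rank (1%:M : 'M[R]_d) < d.+1)%N by rewrite ltnS rank_leq_row.
elim: d.+1 (1%:M) C x => // k IH S C x rkS CS cC compC Cx nAx.
have [S_eq0|S0] := eqVneq S 0.
  exists x => //; split=> //; apply/convex_setP => t y z _ [Cy yx].
  by case: yx; apply/eqP; have := CS _ Cy; rewrite S_eq0 submx0 subr_eq0.
have [u [u0 uS sep]] := separation S0 cA nAx.
have dot_u : continuous (dot u).
  by apply: dot_continuous => y; [exact: cst_continuous|].
have [w /set_mem Cw w_max] : exists2 w, w \in C &
    forall y, y \in C -> dot u y <= dot u w.
  apply: EVT_max_rV => //; first by exists x.
  exact: continuous_subspaceT.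
pose F := C `&` [set y | dot u y = dot u w].
have [x' [Cx' x'w] nAx'] : exists2 x', F x' & ~ A x'.
  have [xw|xw] := eqVneq (dot u x) (dot u w); first by exists x.
  exists w => // Aw; have := sep _ Aw (CS _ Cw).
  by rewrite leNgt lt_neqAle xw w_max// inE.
(* Directions within the face are orthogonal to [u], that is, in [kermx u^T]. The rank drops
   strictly because [u] lies in [S] but is not orthogonal to itself. *)
have [| | | |//|//|z Fz nAz] := IH (S :&: kermx u^T)%MS F x'.
- apply: leq_trans (rank_ltmx _) rkS.
  rewrite ltmxE capmxSl/=.
  apply: contraTN (dot_gt0 u0) => /(submx_trans uS).
  rewrite sub_capmx => /andP[_ /sub_kermxP]; rewrite dot_mulmx => /matrixP/(_ 0 0).
  by rewrite !mxE eqxx mulr1n => ->; rewrite ltxx.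
- move=> y [Cy yw]; rewrite sub_capmx; apply/andP; split.
    rewrite (_ : y - x' = (y - x) - (x' - x)); last by rewrite opprB addrA subrK.
    by rewrite addmx_sub ?CS// eqmx_opp CS.
  apply/sub_kermxP; rewrite dot_mulmx dotC dotBr yw x'w subrr.
  exact: raddf0.
- apply/convex_setP => t y z t01 [Cy yw] [Cz zw]; split.
    by move/convex_setP: cC; exact.
  by rewrite /= dotDr !dotZr yw zw -mulrDl addrC subrK mul1r.
- apply: compact_closedI => //.
  apply: (@preimage_closed _ _ (dot u) [set r | r = dot u w]).
    exact: in1W.
  exact: closed_eq.
exists z => //; apply: extreme_point_face Fz => // y Cy.
by apply: w_max; rewrite inE.
Qed.

End Separation.

(** * Extreme points of the hull of a family in general position *)

Section ConvHull.
Context {R : realType} {d : nat}.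
Local Notation V := 'rV[R]_d.
Implicit Types (A C : set V) (z : V).

Lemma convex_conv_hull A : @convex_set R V (conv_hull A).
Proof.
apply/convex_setP => t x y t01 Ax Ay B [cB AB].
by move/convex_setP: (cB); apply=> //; [exact: Ax|exact: Ay].
Qed.

Lemma aff_dim_set1 z : aff_dim [set z] = 0.
Proof.
rewrite /aff_dim; set m := (\max_(_ < _ | _) _)%N.
suff -> : m = 1%N by [].
apply/eqP; rewrite eqn_leq; apply/andP; split.
  apply/bigmax_leqP => k /asboolP[x [xz x_free]].
  rewrite leqNgt; apply/negP => k_gt1.
  pose i0 := Ordinal (ltnW k_gt1); pose i1 := Ordinal k_gt1.
  pose a (i : 'I_k) : R := (i == i0)%:R - (i == i1)%:R.
  have a_sum : \sum_i a i = 0.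
    have delta_sum j : \sum_i (i == j)%:R = 1 :> R.
      by rewrite (bigD1 j)//= eqxx big1 ?addr0// => i /negPf ->.
    by rewrite /a sumrB !delta_sum subrr.
  have : a i0 = 0.
    apply: x_free => //; transitivity (\sum_i a i *: z).
      by apply: eq_bigr => i _; rewrite xz.
    by rewrite -scaler_suml a_sum scale0r.
  by rewrite /a eqxx /= subr0 => /eqP; rewrite oner_eq0.
have z_free : @affinely_independent R d 1 (fun=> z).
  by move=> a; rewrite big_ord1 => a0 _ i; rewrite ord1.
apply: (@leq_bigmax_cond _ _ (@nat_of_ord d.+2) (Ordinal (isT : (1 < d.+2)%N))).
apply/asboolP; exists (fun=> z); split=> //; exact: z_free.
Qed.

(** Separating [z] from the convex set [C] without [z] gives a supporting hyperplane through [z]. *)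
Lemma extreme_point_supporting C z : extreme_point C z -> aff_dim C != 0 ->
  exists2 F, exposed_face C F & F z.
Proof.
move=> [Cz cCz] dimC.
(* A zero identity matrix means [d = 0]; then [C] is a single point, of dimension 0. *)
have I_neq0 : 1%:M != 0 :> 'M[R]_d.
  apply: contra_neq dimC => I0.
  suff -> : C = [set z] by exact: aff_dim_set1.
  apply/seteqP; split=> [y _|_ ->//] /=.
  by rewrite -[y]mulmx1 -[z]mulmx1 I0 !mulmx0.
have [|u [u0 _ sep]] := separation I_neq0 cCz (x := z).
  by move=> -[_]; exact.
exists (C `&` [set x | dot u x = dot u z]) => //.
exists [set x | dot u x = dot u z] => //; exists u, (dot u z); split=> //.
  move=> x Cx; have [->//|/eqP xz] := eqVneq x z.
  by apply: sep => //; exact: submx1.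
by exists z.
Qed.

Section Family.
Context {I : Type}.
Variable L : I -> set V.
Local Notation C := (conv_hull (\bigcup_i L i)).

(** Otherwise [C] without [z] would be a convex set containing every [L i], hence the whole hull. *)
Lemma extreme_point_member z : extreme_point C z -> exists i, L i z.
Proof.
move=> [Cz cCz]; apply: contrapT => nL.
suff [_] : (C `\ z) z by exact.
apply: (smallest_sub cCz _ Cz) => x [i _ Lix]; split.
  by apply: sub_gen_smallest; exists i.
by move=> xz; apply: nL; exists i; rewrite -xz.
Qed.

(** For the singleton of [z] the bound is 1 and each member through [z] adds 1 to the sum, so two
    distinct members are too many. Since [meeting] collects sets rather than indices, the conclusion
    equates [L i] and [L j]. *)
Lemma extreme_point_unique_member z i j : general_position L ->
  0 < aff_dim C -> extreme_point C z -> L i z -> L j z -> L i = L j.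
Proof.
move=> gp dimC zC Liz Ljz.
have [|F FC Fz] := extreme_point_supporting zC; first by rewrite gt_eqF.
have [|||fin_M] := gp F [set z] FC.
- by move=> _ ->.
- apply: accessible_closed_set1; apply: hausdorff_accessible.
  exact: norm_hausdorff.
- apply/convex_setP => t _ _ _ -> ->.
  by rewrite /= -scalerDl addrC subrK scale1r.
have term K : meeting L [set z] K -> 1 + aff_dim ([set z] `&` K) = 1.
  move=> [_ [y [Ky /= yz]]]; rewrite yz in Ky.
  by rewrite (_ : _ `&` _ = [set z]) ?aff_dim_set1//; apply: setIidl => _ ->.
rewrite aff_dim_set1 (eq_fsbigr (fun=> 1)) => [|K /set_mem/term//].
apply: contraPP => LiNj; apply/negP; rewrite -ltNge.
have M_L k : L k z -> meeting L [set z] (L k) by split=> //; exists z.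
rewrite (fsbigD1 (L i))//=; last exact: M_L.
rewrite (fsbigD1 (L j))//=; last 2 first.
- exact: finite_setD.
- by split; [exact: M_L|exact: nesym].
rewrite add0r ltrDl ltr_pwDl//.
exact: fsumr_ge0.
Qed.
End Family.
End ConvHull.

Theorem lemma2p7 (R : realType) (d : nat) (I : Type) (L : I -> set 'rV[R]_d)
  (L_inj : injective L)
  (L_compact : forall i, compact (L i))
  (L_convex : forall i, @convex_set R 'rV[R]_d (L i))
  (conv_compact : compact (conv_hull (\bigcup_i L i)))
  (conv_dim : 0 < aff_dim (conv_hull (\bigcup_i L i)))
  (L_general : general_position L) :
  conv_hull (\bigcup_i L i) = conv_hull (\bigcup_(i in contributing L) L i).
Proof.
apply/seteqP; split=> [x Cx|]; last first.
  apply: sub_smallest2r; first exact: convex_conv_hull.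
  by move=> x [i _ Lix]; exists i.
apply: contrapT => nDx.
have [||z zC nDz] := extreme_point_outside _ conv_compact _ Cx nDx.
- exact: convex_conv_hull.
- exact: convex_conv_hull.
have [i Liz] := extreme_point_member zC.
apply: nDz; apply: sub_gen_smallest; exists i => //= hullE.
(* If dropping [L i] left the hull unchanged, [z] would lie in the hull of the other members. By
   injectivity of [L] these differ from [L i], so they avoid [z], and their hull stays within [C]
   without [z]. *)
case: zC (zC) => Cz cCz zC; move: Cz; rewrite hullE => Cz.
suff [_] : (conv_hull (\bigcup_k L k) `\ z) z by exact.
apply: (smallest_sub cCz _ Cz) => y [j /= ji Ljy]; split.
  by apply: sub_gen_smallest; exists j.
move=> yz; apply: ji; apply: L_inj; rewrite yz in Ljy.
exact: extreme_point_unique_member Ljy Liz.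
Qed.
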